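(* Let $y:[0,\tau_f]\to\mathbb{R}^{n_y}$ be a solution of the time-freezing system with friction $y'\in F_{\mathrm{TF}}(y,u)$ (defined in the context, using the auxiliary dynamics $f_{\mathrm{aux,n}}$, $f^{\pm}_{\mathrm{aux,t}}$ given there), with $y(0)\in\Sigma$, and suppose that $\varphi(x(\tau),u(\tau))\le0$ for all $\tau\in[0,\tau_f]$ (persistent contact). Then: (i) if $v_{\mathrm{t}}\neq0$ (slip motion), the sliding mode dynamics are given by $y'=\gamma(x,u)\,(f_{\mathrm{Slip}}(x,u),1)$; (ii) if $v_{\mathrm{t}}=0$ (stick motion), the sliding mode dynamics are given by $y'=\gamma(x,u)\,(f_{\mathrm{Stick}}(x,u),1)$, where $\gamma(x,u)\in(0,1]$ is the time-rescaling factor $\gamma(x,u)=\dfrac{D(q)a_{\mathrm{n}}}{D(q)a_{\mathrm{n}}-\varphi(x,u)}$.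
   Context: Let $f_v:\mathbb{R}^{n_q}\times\mathbb{R}^{n_q}\times\mathbb{R}^{n_u}\to\mathbb{R}^{n_q}$, $M:\mathbb{R}^{n_q}\to\mathbb{R}^{n_q\times n_q}$ (symmetric positive definite values) and $f_c:\mathbb{R}^{n_q}\to\mathbb{R}$ be at least twice continuously differentiable; $x=(q,v)$, $n(q):=\nabla_qf_c(q)$. Planar contact: $b:\mathbb{R}^{n_q}\to\mathbb{R}^{n_q}$ (smooth) spans the tangent space at contact points, and it is assumed that $b(q)^\top M(q)^{-1}n(q)=0$. Tangential velocity $v_{\mathrm{t}}:=b(q)^\top v$. Coefficient of friction $\mu>0$. Define $D(q):=n(q)^\top M(q)^{-1}n(q)$, $\varphi(x,u):=n(q)^\top f_v(q,v,u)+\nabla_q(n(q)^\top v)^\top v$, and with $N(q):=[n(q)\ b(q)]\in\mathbb{R}^{n_q\times2}$: $\tilde D(q):=N(q)^\top M(q)^{-1}N(q)$, $\tilde\varphi(x,u):=N(q)^\top f_v(q,v,u)+\nabla_q(N(q)^\top v)^\top v$. Let $f_{\mathrm{ODE}}(x,u)=(v,f_v(q,v,u))$, $f_{\mathrm{Slip}}(x,u):=\big(v,\ f_v(q,v,u)-M(q)^{-1}D(q)^{-1}\varphi(x,u)\,(n(q)-b(q)\mu\,\tfrac{v_{\mathrm{t}}}{|v_{\mathrm{t}}|})\big)$, $f_{\mathrm{Stick}}(x,u):=\big(v,\ f_v(q,v,u)-M(q)^{-1}N(q)\tilde D(q)^{-1}\tilde\varphi(x,u)\big)$. Time-freezing system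 with friction: state $y=(x,t)\in\mathbb{R}^{n_y}$, $n_y=2n_q+1$, clock state $t$, numerical time $\tau$, $y'=\mathrm{d}y/\mathrm{d}\tau$, given control $u(\tau)$. Switching functions $c_1(y)=f_c(q)$, $c_2(y)=n(q)^\top v$, $c_3(y)=b(q)^\top v$; $Q:=\{y: c_1(y)<0,\ c_2(y)<0\}$; regions $R_1=\{c_1>0\}\cup\{c_1<0,\ c_2>0\}$, $R_2=Q\cap\{c_3>0\}$, $R_3=Q\cap\{c_3<0\}$. With constants $a_{\mathrm{n}}>0$ and $a_{\mathrm{t}}=\mu a_{\mathrm{n}}$, set $f_{\mathrm{aux,n}}(y)=(\mathbf{0}_{n_q,1},M(q)^{-1}n(q)a_{\mathrm{n}},0)$, $f^-_{\mathrm{aux,t}}(y)=(\mathbf{0}_{n_q,1},M(q)^{-1}b(q)a_{\mathrm{t}},0)$, $f^+_{\mathrm{aux,t}}=-f^-_{\mathrm{aux,t}}$, and $f_1(y,u)=(f_{\mathrm{ODE}}(x,u),1)$, $f_2=f_{\mathrm{aux,n}}+f^+_{\mathrm{aux,t}}$, $f_3=f_{\mathrm{aux,n}}+f^-_{\mathrm{aux,t}}$. The time-freezing system is the Filippov inclusion $y'\in F_{\mathrm{TF}}(y,u):=\{\sum_{i=1}^3\theta_if_i\mid\sum_i\theta_i=1,\ \theta\ge0,\ \theta_i=0\text{ if }y\notin\overline{R_i}\}$. Let $\Sigma:=\{y\mid f_c(q)=0,\ n(q)^\top v=0\}$; a sliding mode is an evolution on $\Sigma$. *)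

(* Defs.v *)
From HB Require Import structures.
From mathcomp Require Import all_boot all_order all_algebra.
From mathcomp Require Import all_classical all_reals all_analysis.
Set Implicit Arguments. Unset Strict Implicit. Unset Printing Implicit Defensive.
Import Order.TTheory GRing.Theory Num.Theory.
Import numFieldNormedType.Exports.
Local Open Scope classical_set_scope.
Local Open Scope ring_scope.

(* C^k regularity between normed spaces: all directional derivatives exist
   and (recursively) are C^(k-1); C^0 = continuous.  In finite dimension
   this is the usual notion of k times continuously differentiable. *)
Fixpoint Ck {R : realType} {U V : normedModType R} (k : nat) (f : U -> V)
  : Prop :=
  match k with
  | 0 => continuous f
  | k'.+1 => forall w : U, (forall x, derivable f x w) /\
                           Ck k' (fun x => 'D_w f x)
  end.

Definition smooth {R : realType} {U V : normedModType R} (f : U -> V) :=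
  forall k, Ck k f.

Definition abs_cont_on {R : realType} {V : normedModType R}
  (f : R -> V) (a b : R) : Prop :=
  forall e : R, 0 < e -> exists2 d : R, 0 < d &
    forall (k : nat) (s : 'I_k -> R * R),
      (forall i, a <= (s i).1 /\ (s i).1 <= (s i).2 /\ (s i).2 <= b) ->
      (forall i j, i != j -> (s i).2 <= (s j).1 \/ (s j).2 <= (s i).1) ->
      \sum_(i < k) ((s i).2 - (s i).1) < d ->
      \sum_(i < k) `|f (s i).2 - f (s i).1| < e.

Section TF.
Variables (R : realType) (nq nu : nat).
Local Notation Q := 'cV[R]_nq.
Local Notation U := 'cV[R]_nu.
(* state y = ((q, v), t) *)
Local Notation Y := ((Q * Q) * R)%type.

Definition dotv (a b : Q) : R := (a^T *m b) 0 0.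
Definition ecol (i : 'I_nq) : Q := delta_mx i 0.
Definition grad (f : Q -> R) (q : Q) : Q := \col_i 'D_(ecol i) f q.

Variables (fv : Q * Q * U -> Q) (M : Q -> 'M[R]_nq) (fc : Q -> R)
          (b : Q -> Q) (mu an : R).

Definition nrm (q : Q) : Q := grad fc q.
Definition Dq (q : Q) : R := dotv (nrm q) (invmx (M q) *m nrm q).
Definition phi (q v : Q) (u : U) : R :=
  dotv (nrm q) (fv (q, v, u)) + 'D_v (fun q' => dotv (nrm q') v) q.
Definition Nm (q : Q) : 'M[R]_(nq, 1 + 1) := row_mx (nrm q) (b q).
Definition Dtil (q : Q) : 'M[R]_(1 + 1) := (Nm q)^T *m invmx (M q) *m Nm q.
Definition phitil (q v : Q) (u : U) : 'cV[R]_(1 + 1) :=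
  (Nm q)^T *m fv (q, v, u) + 'D_v (fun q' => (Nm q')^T *m v) q.
Definition vt (q v : Q) : R := dotv (b q) v.

Definition gamma (q v : Q) (u : U) : R :=
  Dq q * an / (Dq q * an - phi q v u).

(* velocity components of f_Slip and f_Stick (position component is v) *)
Definition fSlip_v (q v : Q) (u : U) : Q :=
  fv (q, v, u) - (phi q v u / Dq q) *:
     (invmx (M q) *m (nrm q - (mu * (vt q v / `|vt q v|)) *: b q)).
Definition fStick_v (q v : Q) (u : U) : Q :=
  fv (q, v, u) - invmx (M q) *m Nm q *m (invmx (Dtil q) *m phitil q v u).

Definition c1 (y : Y) : R := fc y.1.1.
Definition c2 (y : Y) : R := dotv (nrm y.1.1) y.1.2.
Definition c3 (y : Y) : R := vt y.1.1 y.1.2.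
Definition Qreg : set Y := [set y | c1 y < 0 /\ c2 y < 0].
Definition R1 : set Y := [set y | 0 < c1 y] `|` [set y | c1 y < 0 /\ 0 < c2 y].
Definition R2 : set Y := Qreg `&` [set y | 0 < c3 y].
Definition R3 : set Y := Qreg `&` [set y | c3 y < 0].
Definition Sigma : set Y := [set y | c1 y = 0 /\ c2 y = 0].

Definition at_ : R := mu * an.
Definition f1 (y : Y) (u : U) : Y := (y.1.2, fv (y.1.1, y.1.2, u), 1).
Definition faux_n (y : Y) : Y := (0, an *: (invmx (M y.1.1) *m nrm y.1.1), 0).
Definition faux_tm (y : Y) : Y := (0, at_ *: (invmx (M y.1.1) *m b y.1.1), 0).
Definition faux_tp (y : Y) : Y := - faux_tm y.
Definition f2 (y : Y) : Y := faux_n y + faux_tp y.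
Definition f3 (y : Y) : Y := faux_n y + faux_tm y.

Definition F_TF (y : Y) (u : U) : set Y :=
  [set z | exists th1 th2 th3 : R,
     [/\ [/\ 0 <= th1, 0 <= th2 & 0 <= th3], th1 + th2 + th3 = 1,
         [/\ (~ closure R1 y -> th1 = 0), (~ closure R2 y -> th2 = 0)
           & (~ closure R3 y -> th3 = 0)]
       & z = th1 *: f1 y u + th2 *: f2 y + th3 *: f3 y]].

Definition TF_solution (y : R -> Y) (u : R -> U) (tauf : R) : Prop :=
  abs_cont_on y 0 tauf /\
  {ae (@lebesgue_measure R), forall tau, tau \in `[0, tauf] ->
     derivable y tau 1 /\ F_TF (y tau) (u tau) ('D_1 y tau)}.

End TF.

(* Main.v *)
(** On [c2 > 0] only the free dynamics is active and [c2' = phi <= 0]; hence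
    [c2 <= 0] throughout, and then [c1' = theta_1 c2 <= 0] gives [c1 <= 0].  On
    [c2 < 0] the free dynamics is switched off almost everywhere, so
    [c2' = D a_n >= 0] and the trajectory never leaves [Sigma].  There [c2' = 0]
    forces [theta_1 = gamma].  If [v_t <> 0], its sign leaves a single auxiliary
    field; if [v_t = 0], almost everywhere also [c3' = 0], and the two equations
    [c2' = c3' = 0] form the linear system with matrix [Dtil] defining the
    stick dynamics. *)

Require Import Defs.
From HB Require Import structures.
From mathcomp Require Import all_boot all_order all_algebra.
From mathcomp Require Import all_classical all_reals all_analysis.
From mathcomp Require Import lra ring.
Set Implicit Arguments.
Unset Strict Implicit.
Unset Printing Implicit Defensive.
Import Order.TTheory GRing.Theory Num.Theory.
Import numFieldNormedType.Exports.
Local Open Scope classical_set_scope.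
Local Open Scope ring_scope.

(** A solution is only absolutely continuous, obeys the inclusion only almost everywhere, and its
    right-hand side jumps at [Sigma]; signs therefore cannot be propagated by pointwise derivative
    arguments. Each bound on a switching function is instead one use of [barrier], which asks for
    the sign of the derivative only where the bound is already violated, that is, where the regions
    determine the Filippov weights. The equations [c2' = 0] and [c3' = 0] rest on a different fact:
    a real function can vanish with nonzero derivative only on a countable set of times. Since [Ck]
    speaks of directional derivatives alone, strict differentiability of [Ck 1] functions is proved
    first; it yields both the chain rule along solutions and the local Lipschitz bounds that keep
    the switching functions absolutely continuous along them. *)

(** * Absolutely continuous functions, null sets and a barrier principle *)

(** The continuous induction below adds one interval at a time, to the right of all earlier ones: a
    cons on a list, but a reindexing for families over ['I_k]. *)
Lemma abs_cont_on_seq (R : realType) (V : normedModType R) (f : R -> V)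
    (a b : R) :
  abs_cont_on f a b -> forall e : R, 0 < e -> exists2 d : R, 0 < d &
    forall l : seq (R * R),
      all (fun p => [&& a <= p.1, p.1 <= p.2 & p.2 <= b]) l ->
      pairwise (fun p p' => p'.2 <= p.1) l ->
      \sum_(p <- l) (p.2 - p.1) < d ->
      \sum_(p <- l) `|f p.2 - f p.1| < e.
Proof.
move=> fac e e0; have [d d0 fd] := fac e e0; exists d => // l.
move=> /(all_nthP (0, 0)) lab /(pairwiseP (0, 0)) lpw.
rewrite !(big_nth (0, 0)) !big_mkord => ld.
apply: (fd _ (fun i => nth (0, 0) l i)) => // [i|i j ij].
  by have /and3P[] := lab i (ltn_ord i).
have [?|?|/val_inj ijE] := ltngtP i j.
- by right; apply: lpw => //; rewrite inE.
- by left; apply: lpw => //; rewrite inE.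
- by rewrite ijE eqxx in ij.
Qed.

Lemma negligible_open_cover (R : realType) (N : set R) (d : R) :
  (@lebesgue_measure R).-negligible N -> 0 < d ->
  exists G : set R, [/\ open G, N `<=` G & (lebesgue_measure G < d%:E)%E].
Proof.
move=> [A [mA A0 NA]] d0.
have [|G [oG AG GAd]] := @lebesgue_regularity_outer R A d mA _ d0.
  by move: A0 => /= ->.
exists G; split=> //; first exact: subset_trans AG.
rewrite -(setDUK AG) (le_lt_trans _ GAd)// (le_trans (measureU2 _ _ _))//.
- by apply: measurableD => //; exact: measurable_realfun.open_measurable.
- by move: A0 => /= ->; rewrite add0e.
Qed.

(* Continuous induction: the increments of [h] up to [t] are controlled by the
   slope [e] outside the open cover [G] of the exceptional null set, and by the
   variation of [h] over finitely many disjoint intervals lying in [G]. *)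
Lemma abs_cont_nonincreasing (R : realType) (h : R -> R) (a b : R) :
  a <= b -> abs_cont_on h a b ->
  {ae (@lebesgue_measure R), forall t, t \in `]a, b[ ->
     derivable h t 1 /\ 'D_1 h t <= 0} ->
  h b <= h a.
Proof.
move=> ab hac hae.
(* The part [e * (b - a)] pays for the slope outside [G], the extra [e] for the variation of [h]
   over the intervals inside [G]. *)
suff hab (e : R) : 0 < e -> h b - h a <= e * (b - a + 1).
  rewrite leNgt; apply/negP => hba.
  have ba : 0 < b - a + 1 by rewrite ltr_wpDl// subr_ge0.
  have := hab ((h b - h a) / 2 / (b - a + 1)).
  rewrite !divr_gt0 ?subr_gt0// => /(_ isT).
  rewrite divfK ?gt_eqF//; lra.
move=> e0; have [d d0 hd] := abs_cont_on_seq hac e0.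
pose N := ~` [set t | t \in `]a, b[ -> derivable h t 1 /\ 'D_1 h t <= 0].
(* The endpoints join the exceptional set because the derivative is controlled only on the open
   interval. *)
have [G [oG NabG Gd]] : exists G : set R,
    [/\ open G, N `|` [set a; b] `<=` G & (lebesgue_measure G < d%:E)%E].
  apply: negligible_open_cover => //; apply: negligibleU => //.
  by apply/negligibleP; [exact: measurableU|
    exact/countable_lebesgue_measure0/finite_set_countable].
have mG : measurable G by exact: measurable_realfun.open_measurable.
(* Charging the total length of the list to the measure of [G] on [[a, t[], rather than to [d],
   makes the invariant stable when an interval is added on the right. *)
pose P t := exists l : seq (R * R),
  [/\ all (fun p => [&& a <= p.1, p.1 <= p.2 & p.2 <= t]) l,
      pairwise (fun p p' => p'.2 <= p.1) l,
      ((\sum_(p <- l) (p.2 - p.1))%:E <= lebesgue_measure (G `&` `[a, t[))%E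
    & h t - h a <= e * (t - a) + \sum_(p <- l) `|h p.2 - h p.1|].
have Pstep s t : a <= s -> s <= t -> P s ->
    h t - h s <= e * (t - s) \/ `[s, t[ `<=` G -> P t.
  move=> as_ st [l [lP lpw lG lh]] [hst|stG].
    exists l; split=> //.
    - apply: sub_all lP => p /and3P[-> -> /=] /le_trans; exact.
    - apply: (le_trans lG); apply: le_measure; rewrite ?inE.
      + by apply: measurableI.
      + by apply: measurableI.
      + by apply: setIS; apply: subset_itvl; rewrite bnd_simp.
    - lra.
  exists ((s, t) :: l); split=> /=.
  - rewrite as_ st lexx /=.
    apply: sub_all lP => p /and3P[-> -> /=] /le_trans; exact.
  - rewrite lpw andbT; apply: sub_all lP => p /and3P[_ _ ]; exact.
  - rewrite big_cons/= EFinD.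
    have -> : G `&` `[a, t[ = `[s, t[ `|` (G `&` `[a, s[).
      apply/seteqP; split=> x /=; rewrite !in_itv /=.
        move=> [Gx /andP[ax xt]]; have [sx|xs] := leP s x.
          by left; rewrite xt.
        by right; rewrite ax.
      move=> [/andP[sx xt]|[Gx /andP[ax xs]]].
        split; first by apply: stG; rewrite /= in_itv /= sx xt.
        by rewrite (le_trans as_ sx) xt.
      by split=> //; rewrite ax (lt_le_trans xs st).
    rewrite measureU//.
    + rewrite leeD//= lebesgue_measure_itv/= lte_fin.
      by case: ltP => // ts; rewrite lee_fin subr_le0.
    + by apply: measurableI.
    + apply/seteqP; split=> x//= []; rewrite !in_itv/=.
      by move=> /andP[sx _] [_ /andP[_]]; rewrite ltNge sx.
  - have : 0 <= e * (t - s) by rewrite mulr_ge0 ?subr_ge0// ltW.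
    by rewrite big_cons/=; have := ler_norm (h t - h s); lra.
have Pa : P a.
  exists [::]; split=> //; first by rewrite big_nil measure_ge0.
  by rewrite big_nil !subrr mulr0 addr0.
pose S := [set t | a <= t <= b /\ P t].
have Sa : S a by rewrite /S/= lexx ab.
have Sb : has_sup S.
  by split; [exists a|exists b => t [/andP[]]].
pose c := sup S.
have ac : a <= c by apply: ub_le_sup => //; case: Sb.
have cb : c <= b by apply: ge_sup; [exists a|move=> t [/andP[]]].
(* If [c] lies in [G], so does a ball around it; otherwise the derivative at [c] is at most 0 and
   nearby difference quotients stay below [e]. Only increments with an endpoint at [c] are
   controlled, which is enough to reach [c] from the left and to leave it on the right. *)
have [r r0 rc] : exists2 r, 0 < r & forall s t, s <= t -> s = c \/ t = c ->
    c - r < s -> t < c + r -> h t - h s <= e * (t - s) \/ `[s, t[ `<=` G.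
  have [Gc|nGc] := pselect (G c).
    have := oG c Gc; move=> /nbhs_ballP[r /= r0 rG].
    exists r => // s t st _ cs tc; right => x /=.
    rewrite in_itv/= => /andP[sx xt].
    apply: rG; rewrite /ball/= ltr_norml; lra.
  have : ~ (N `|` [set a; b]) c by move/NabG.
  rewrite not_orP => -[/contrapT/=+ cab].
  have cab' : c \in `]a, b[.
    rewrite in_itv/= !lt_neqAle ac cb !andbT.
    by apply/andP; split; apply/eqP => ec; apply: cab; [left|right].
  move=> /(_ cab')[dc Dc].
  move: dc => /cvg_ex[/= l hl].
  have lE : 'D_1 h c = l by apply: cvg_lim.
  move/cvgrPdist_lt : hl => /(_ e e0)[r /= r0 rh].
  have {}rh z : z != 0 -> `|z| < r -> z^-1 * (h (z + c) - h c) < e.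
    move=> z0 zr; have := rh z; rewrite /ball_/= sub0r normrN => /(_ zr z0).
    rewrite [_%:A]mulr1 ltr_norml => /andP[+ _].
    rewrite lE in Dc; rewrite /GRing.scale/=; lra.
  exists r => // s t; rewrite le_eqVlt => /predU1P[->|st].
    by left; rewrite !subrr mulr0.
  have st0 : 0 < t - s by rewrite subr_gt0.
  move=> [|] E cs tc; rewrite {}E in st st0 cs tc *; left.
    have := rh (t - c); rewrite  subrK gt_eqF// (gtr0_norm st0) => /(_ isT).
    rewrite ltrBlDl => /(_ tc) /ltW.
    by rewrite ler_pdivrMl// mulrC.
  have := rh (s - c); rewrite subrK lt_eqF ?subr_lt0// ltr0_norm ?subr_lt0//.
  rewrite opprB => /(_ isT); rewrite ltrBlDl -ltrBlDr => /(_ cs) /ltW.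
  by rewrite ler_ndivrMl ?subr_lt0//; lra.
have [s Ss sc] := sup_adherent r0 Sb.
have [/andP[as_ sb] Ps] := Ss.
have sc' : s <= c by apply: ub_le_sup => //; case: Sb.
have Pc : P c.
  apply: (Pstep s) => //; apply: rc => //; [by right| by rewrite ltrDl].
have bc : b <= c.
  rewrite leNgt; apply/negP => cb'.
  pose t := Num.min b (c + r / 2).
  have ct : c < t by rewrite lt_min cb' ltrDl divr_gt0.
  have tb : t <= b by rewrite ge_min lexx.
  have : t <= c.
    apply: ub_le_sup; first by case: Sb.
    split; first by rewrite (le_trans ac (ltW ct)) tb.
    apply: (Pstep c) => //; first exact: ltW.
    apply: rc; [exact: ltW|by left|by rewrite ltrBlDr ltrDl|].
    by rewrite /t gt_min; apply/orP; right; lra.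
  by rewrite leNgt ct.
have {}bc : c = b by apply/eqP; rewrite eq_le cb.
move: Pc; rewrite bc => -[l [lP lpw lG lh]].
have := hd l lP lpw.
have -> : \sum_(p <- l) (p.2 - p.1) < d.
  rewrite -lte_fin; apply: le_lt_trans Gd; apply: (le_trans lG).
  by apply: le_measure; rewrite ?inE//; exact: measurableI.
move=> /(_ isT); rewrite mulrDr mulr1; lra.
Qed.

(** A zero with nonzero derivative is isolated among the zeros, and a set of reals has only
    countably many isolated points. *)
Lemma ae_derive_eq0_on_zeros (R : realType) (h : R -> R) :
  {ae (@lebesgue_measure R), forall t,
     h t = 0 -> derivable h t 1 -> 'D_1 h t = 0}.
Proof.
have iso0 : (@lebesgue_measure R).-negligible (isolated [set t | h t = 0]).
  apply/negligibleP; last exact/countable_lebesgue_measure0/countable_isolated.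
  exact/countable_measurable/countable_isolated.
refine (negligibleS _ iso0) => t /= /not_implyP[ht0 /not_implyP[dh /eqP Dh0]].
split; first exact/mem_set.
have /cvgrPdist_lt :
    z^-1 *: ((h \o shift t) (z *: 1) - h t) @[z --> 0^'] --> 'D_1 h t.
  exact: dh.
(* At another zero the difference quotient would be 0, hence at distance exactly this tolerance from
   the derivative. *)
move=> /(_ `|'D_1 h t|); rewrite normr_gt0 => /(_ Dh0)[/= r r0 rh].
exists (ball t r); first exact: nbhsx_ballx.
apply/seteqP; split=> [s [st /= hs]|_ ->]; last by split=> //; exact: ballxx.
apply/eqP; apply: contraT => nst; have := rh (s - t).
rewrite /ball_/= sub0r normrN distrC => /(_ st); rewrite subr_eq0 => /(_ nst).
by rewrite [_%:A]mulr1 subrK hs ht0 subrr scaler0 subr0 ltxx.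
Qed.

Definition locally_lipschitz_at (R : realType) (V : normedModType R)
    (c : V -> R) (x : V) :=
  exists r L : R, [/\ 0 < r, 0 < L & forall x1 x2, `|x - x1| < r ->
    `|x - x2| < r -> `|c x1 - c x2| <= L * `|x1 - x2|].

(** If [c] were positive at some time, consider the last earlier time [t0] at which it is not. Right
    after [t0] it is positive, hence nonincreasing along [y], so it cannot exceed its value at [t0].
    The argument stays so close to [t0] that a single local Lipschitz constant makes [c \o y]
    absolutely continuous there. *)
Lemma barrier (R : realType) (V : normedModType R) (y : R -> V) (c : V -> R)
    (T : R) :
  abs_cont_on y 0 T -> (forall x, locally_lipschitz_at c x) ->
  c (y 0) <= 0 ->
  {ae (@lebesgue_measure R), forall t, t \in `[0, T] -> 0 < c (y t) ->
     derivable (c \o y) t 1 /\ 'D_1 (c \o y) t <= 0} ->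
  forall t, 0 <= t <= T -> c (y t) <= 0.
Proof.
move=> yac cL cy0 cae t1 /andP[t10 t1T]; rewrite leNgt; apply/negP => ct1.
pose S := [set t | 0 <= t <= t1 /\ c (y t) <= 0].
have S0 : S 0 by rewrite /S/= lexx t10.
have supS : has_sup S by split; [exists 0|exists t1 => t [/andP[]]].
pose t0 := sup S.
have t00 : 0 <= t0 by apply: ub_le_sup => //; case: supS.
have t0t1 : t0 <= t1 by apply: ge_sup; [exists 0|move=> t [/andP[]]].
have [r [L [r0 L0 rL]]] := cL (y t0).
have yc (e : R) : 0 < e -> exists2 d : R, 0 < d & forall s, 0 <= s <= T ->
    `|s - t0| < d -> `|y t0 - y s| < e.
  move=> e0; have [d d0 yd] := abs_cont_on_seq yac e0; exists d => // s sT.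
  have t0T := le_trans t0t1 t1T; case/andP: sT => s0 sT.
  have [st|/ltW ts] := leP s t0.
    rewrite ler0_norm ?subr_le0// opprB => sd.
    have := yd [:: (s, t0)]; rewrite !big_seq1/= s0 st t0T => /(_ isT isT sd).
    by [].
  rewrite ger0_norm ?subr_ge0// => sd.
  have := yd [:: (t0, s)]; rewrite !big_seq1/= t00 ts sT => /(_ isT isT sd).
  by rewrite distrC.
have [d d0 yd] := yc r r0.
have cy s s' : 0 <= s <= T -> `|s - t0| < d -> 0 <= s' <= T ->
    `|s' - t0| < d -> `|c (y s) - c (y s')| <= L * `|y s - y s'|.
  by move=> *; apply: rL; apply: yd.
have t0T : 0 <= t0 <= T by rewrite t00 (le_trans t0t1).
have cyt0 : c (y t0) <= 0.
  apply/ler_addgt0Pr => e e0; rewrite add0r.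
  have [d' d'0 yd'] := yc (e / L) (divr_gt0 e0 L0).
  have [|s Ss st0] := sup_adherent (_ : 0 < Num.min d d') supS.
    by rewrite lt_min d0.
  have [/andP[s0 st1] cs] := Ss.
  have st0' : s <= t0 by apply: ub_le_sup => //; case: supS.
  have sT : 0 <= s <= T by rewrite s0 (le_trans st1).
  have [sd sd'] : `|s - t0| < d /\ `|s - t0| < d'.
    rewrite ler0_norm ?subr_le0//; apply/andP.
    by rewrite -lt_min opprB ltrBlDr -ltrBlDl.
  have := cy t0 s t0T; rewrite subrr normr0 => /(_ d0 sT sd).
  have := yd' s sT sd'; rewrite ltr_pdivlMr// mulrC => /ltW h1 h2.
  have := le_trans h2 h1; rewrite ler_norml => /andP[_]; lra.
have {}t0t1 : t0 < t1.
  by rewrite lt_neqAle t0t1 andbT; apply: contraTneq ct1 => <-; rewrite -leNgt.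
(* Half of [d] keeps all of [[t0, t2]] strictly inside the window where [y] stays in the Lipschitz
   ball. *)
pose t2 := Num.min t1 (t0 + d / 2).
have t02 : t0 < t2 by rewrite lt_min t0t1 ltrDl divr_gt0.
have t2t1 : t2 <= t1 by rewrite ge_min lexx.
have pos t : t0 < t -> t <= t2 -> 0 < c (y t).
  move=> tt tt2; rewrite ltNge; apply/negP => cyt.
  have : t <= t0.
    apply: ub_le_sup; first by case: supS.
    by split=> //; rewrite (le_trans t00 (ltW tt)) (le_trans tt2).
  by rewrite leNgt tt.
have win t : t0 <= t -> t <= t2 -> 0 <= t <= T /\ `|t - t0| < d.
  move=> tt tt2; rewrite (le_trans t00 tt) (le_trans tt2 (le_trans t2t1 t1T)).
  split=> //; rewrite ger0_norm ?subr_ge0// ltrBlDl (le_lt_trans tt2)//.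
  by rewrite gt_min; apply/orP; right; lra.
have : c (y t2) <= c (y t0).
  apply: (@abs_cont_nonincreasing R (c \o y) t0 t2); first exact: ltW.
    move=> e e0; have [d' d'0 yd'] := yac (e / L) (divr_gt0 e0 L0).
    exists d' => // k s sin sdis ssum.
    have := yd' k s _ sdis ssum.
    rewrite ltr_pdivlMr// mulrC mulr_sumr => yL.
    apply: le_lt_trans (yL _).
      apply: ler_sum => i _; have [h1 [h2 h3]] := sin i.
      have [? ?] := win _ (le_trans h1 h2) h3.
      have [? ?] := win _ h1 (le_trans h2 h3).
      exact: cy.
    move=> i; have [h1 [h2 h3]] := sin i; split; first exact: le_trans h1.
    by split=> //; rewrite (le_trans h3)// (le_trans t2t1).
  refine (negligibleS _ cae); apply: subsetC => t cyt /=.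
  rewrite in_itv/= => /andP[h1 h2].
  apply: cyt; first by rewrite in_itv/=; have [] := win t (ltW h1) (ltW h2).
  exact: pos (ltW h2).
by rewrite leNgt (le_lt_trans cyt0)// pos.
Qed.

(** * Calculus of continuously differentiable functions on column vectors *)

Lemma mx_norm_ltP (R : realType) m n (A : 'M[R]_(m, n)) (r : R) : 0 < r ->
  reflect (forall i j, `|A i j| < r) (`|A| < r).
Proof.
move=> r0; rewrite [X in X < _]/Num.Def.normr/= mx_normrE.
apply: (iffP (bigmax_ltP _ _ _ _)) => [[_ Ar] i j|Ar]; first exact: (Ar (i, j)).
by split=> // -[i j] _; exact: Ar.
Qed.

Lemma mx_entry_le_norm (R : realType) m n (A : 'M[R]_(m, n)) i j :
  `|A i j| <= `|A|.
Proof. by rewrite [leRHS]/Num.Def.normr/= mx_normrE (le_bigmax _ _ (i, j)). Qed.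

Lemma is_derive_line (R : realType) (V W : normedModType R) (f : V -> W)
    (z w : V) (t : R) :
  derivable f (z + t *: w) w ->
  is_derive t 1 (fun s : R => f (z + s *: w)) ('D_w f (z + t *: w)).
Proof.
move=> df.
have fE : (fun h => h^-1 *: (((fun s => f (z + s *: w)) \o shift t) (h *: 1)
     - f (z + t *: w)))
   = (fun h => h^-1 *: ((f \o shift (z + t *: w)) (h *: w) - f (z + t *: w))).
  by apply/funext => h /=; rewrite [_%:A]mulr1 scalerDl addrCA.
by split; rewrite /derivable/derive fE.
Qed.

Lemma mean_value_direction (R : realType) (V : normedModType R) (f : V -> R)
    (w z : V) (s l e : R) :
  (forall x, derivable f x w) ->
  (forall t : R, 0 <= t <= 1 -> `|'D_w f (z + (t * s) *: w) - l| <= e) ->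
  `|f (z + s *: w) - f z - s * l| <= e * `|s|.
Proof.
move=> df.
(* A negative [s] reduces to this case by reversing the segment: base point [z + s *: w], parameter
   [1 - t]. *)
have pos z' (s' : R) : 0 < s' ->
    (forall t : R, 0 <= t <= 1 -> `|'D_w f (z' + (t * s') *: w) - l| <= e) ->
    `|f (z' + s' *: w) - f z' - s' * l| <= e * s'.
  move=> s0 He.
  have dg (t : R) : is_derive t 1 (fun s : R => f (z' + s *: w))
      ('D_w f (z' + t *: w)).
    exact: is_derive_line.
  have [|c] := @MVT_segment R (fun s => f (z' + s *: w))
    (fun t => 'D_w f (z' + t *: w)) 0 s' (ltW s0) (fun t _ => dg t).
    apply: derivable_within_continuous => t _; exact: ex_derive.
  rewrite in_itv/= scale0r addr0 subr0 => /andP[c0 cs] ->.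
  rewrite [s' * l]mulrC -mulrBl normrM (gtr0_norm s0).
  rewrite ler_wpM2r//; first exact: ltW.
  have := He (c / s'); rewrite divfK ?gt_eqF//. apply.
  by rewrite divr_ge0 ?(ltW s0)//= ler_pdivrMr// mul1r.
have [s0 He|s0 He|->] := ltgtP s 0.
- have := pos (z + s *: w) (- s).
  rewrite oppr_gt0 (ltr0_norm s0) -[z + _ + _]addrA -scalerDl subrr scale0r.
  rewrite addr0 mulNr -normrN (_ : - (_ - _) = f (z + s *: w) - f z - s * l).
    move=> /(_ s0); apply => t /andP[t0 t1]; have := He (1 - t).
    rewrite -[z + _ + _]addrA -scalerDl mulrBl mul1r mulrN; apply.
    by rewrite subr_ge0 t1/= gerBl.
  by ring.
- by rewrite (gtr0_norm s0); exact: pos.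
- by rewrite scale0r addr0 subrr mul0r subrr normr0 mulr0.
Qed.

(* The increment is split along the coordinate path from [x'] to [x], which
   stays in the (box-shaped) ball. *)
Lemma Ck1_strictly_differentiable (R : realType) n (f : 'cV[R]_n -> R)
    (x0 : 'cV[R]_n) (e : R) :
  Ck 1 f -> 0 < e -> exists2 r : R, 0 < r & forall x x',
    `|x0 - x| < r -> `|x0 - x'| < r ->
    `|f x - f x' - dotv (grad f x0) (x - x')| <= e * `|x - x'|.
Proof.
move=> fC e0; pose e' := e / n.+1%:R.
have e'0 : 0 < e' by rewrite divr_gt0.
have : \forall x \near x0, forall i : 'I_n,
    `|'D_(ecol R i) f x - 'D_(ecol R i) f x0| < e'.
  refine (@filter_forall _ _ (fun i : 'I_n =>
    [set x | `|'D_(ecol R i) f x - 'D_(ecol R i) f x0| < e'])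
    _ (nbhs_filter x0) _).
  by move=> i; have [_ /(_ x0)/cvgr_distC_lt] := fC (ecol R i); apply.
move=> /nbhs_ballP[r /= r0 rD]; exists r => // x x' xr x'r.
pose z k : 'cV[R]_n := \col_i (if (i < k)%N then x i 0 else x' i 0).
have zS (k : 'I_n) : z k.+1 = z k + (x k 0 - x' k 0) *: ecol R k.
  apply/colP => i; rewrite !mxE eqxx andbT ltnS leq_eqVlt.
  have [->|ik] := eqVneq i k; first by rewrite eqxx ltnn mulr1 subrKC.
  by rewrite (negbTE (_ : val i != val k))// mulr0 addr0.
have z0 : z 0%N = x' by apply/colP => i; rewrite !mxE.
have zn : z n = x by apply/colP => i; rewrite !mxE ltn_ord.
have -> : f x - f x' = \sum_(k < n) (f (z k.+1) - f (z k)).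
  have := telescope_sumr (fun k => f (z k)) (leq0n n).
  by rewrite zn z0 big_mkord => ->.
have -> : dotv (grad f x0) (x - x') =
    \sum_(k < n) (x k 0 - x' k 0) * 'D_(ecol R k) f x0.
  by rewrite /dotv mxE; apply: eq_bigr => k _; rewrite !mxE mulrC.
rewrite -sumrB (le_trans (ler_norm_sum _ _ _))//.
apply: (@le_trans _ _ (\sum_(k < n) e' * `|x - x'|)).
  apply: ler_sum => k _; rewrite zS.
  apply: (@le_trans _ _ (e' * `|x k 0 - x' k 0|)).
    apply: mean_value_direction => [y|t /andP[t0 t1]].
      by have [] := fC (ecol R k).
    apply/ltW/rD; rewrite -ball_normE/=; apply/mx_norm_ltP => // i j.
    rewrite ord1 !mxE; move/mx_norm_ltP : xr => /(_ r0 i 0).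
    move/mx_norm_ltP : x'r => /(_ r0 i 0); rewrite !mxE.
    have [->|ik] := eqVneq i k; last by case: ifP => _; rewrite mulr0 addr0.
    rewrite ltnn mulr1 => h1 h2.
    (* The moving coordinate is a convex combination of those of [x'] and [x], so it stays within
       [r] of that of [x0]. *)
    rewrite (_ : _ - _ = (1 - t) * (x0 k 0 - x' k 0) + t * (x0 k 0 - x k 0));
      last by ring.
    move: t0; rewrite le_eqVlt => /predU1P[<-|t0].
      by rewrite mul0r addr0 subr0 mul1r.
    rewrite (le_lt_trans (ler_normD _ _))// !normrM (gtr0_norm t0).
    rewrite ger0_norm ?subr_ge0// [ltRHS](_ : r = (1 - t) * r + t * r);
      last by ring.
    by rewrite ler_ltD// ?ltr_pM2l// ler_wpM2l ?subr_ge0// ltW.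
  rewrite ler_wpM2l//; first exact: ltW.
  by have := mx_entry_le_norm (x - x') k 0; rewrite !mxE.
rewrite sumr_const card_ord -mulrnAl ler_wpM2r// /e' -mulr_natr -mulrA.
by rewrite ler_piMr ?(ltW e0)// mulrC ler_pdivrMr// mul1r ler_nat.
Qed.

Lemma dotvE (R : realType) n (a w : 'cV[R]_n) :
  dotv a w = \sum_i a i 0 * w i 0.
Proof. by rewrite /dotv mxE; apply: eq_bigr => i _; rewrite mxE. Qed.

Fact dotv_is_linear (R : realType) n (a : 'cV[R]_n) :
  linear (dotv a : 'cV[R]_n -> R^o).
Proof. by move=> k x z; rewrite /dotv mulmxDr -scalemxAr !mxE. Qed.

HB.instance Definition _ (R : realType) n (a : 'cV[R]_n) :=
  GRing.isLinear.Build R 'cV[R]_n R^o _ (dotv a) (dotv_is_linear a).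

Lemma dotv_le_norm (R : realType) n (a w : 'cV[R]_n) :
  `|dotv a w| <= (\sum_i `|a i 0|) * `|w|.
Proof.
rewrite dotvE mulr_suml (le_trans (ler_norm_sum _ _ _))// ler_sum// => i _.
by rewrite normrM ler_wpM2l// mx_entry_le_norm.
Qed.

Lemma dotv_continuous (R : realType) n (a : 'cV[R]_n) :
  continuous (dotv a : 'cV[R]_n -> R).
Proof.
move=> x; apply/(@cvgrPdist_le _ _ _ _ (nbhs_filter x)) => e e0.
have L0 : 0 < \sum_i `|a i 0| + 1 by rewrite ltr_wpDl// sumr_ge0.
near=> z.
rewrite -[_ - _](raddfB (dotv a)) (le_trans (dotv_le_norm _ _))//.
apply: (@le_trans _ _ ((\sum_i `|a i 0| + 1) * `|x - z|)).
  by rewrite ler_wpM2r// lerDl.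
rewrite mulrC -ler_pdivlMr//; near: z.
apply: (@cvgr_dist_le _ _ _ _ (nbhs_filter x) id x); first exact: cvg_id.
by rewrite divr_gt0.
Unshelve. all: by end_near. Qed.

Lemma is_diff_from_increments (R : realType) (V W : normedModType R)
    (f : V -> W) (df : {linear V -> W}) (x : V) :
  continuous df ->
  (forall e : R, 0 < e -> exists2 r : R, 0 < r & forall w, `|w| < r ->
     `|f (w + x) - f x - df w| <= e * `|w|) ->
  is_diff x f df.
Proof.
move=> dfc fdf.
have fE : f \o shift x = cst (f x) + df +o_ 0 id.
  apply/eqaddoP => e e0; have [r r0 rf] := fdf e e0.
  near=> w; rewrite /= -[X in `|X|]/(f (w + x) - (f x + df w)) opprD addrA.
  by apply: rf; near: w; exact: nbhs0_lt.
have dfE := diff_unique dfc fE.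
split; last exact: dfE.
by apply/diff_locallyP; rewrite dfE; split; [exact: dfc|exact: fE].
Unshelve. all: by end_near. Qed.

Lemma Ck1_is_diff (R : realType) n (f : 'cV[R]_n -> R) (x : 'cV[R]_n) :
  Ck 1 f -> is_diff x f (dotv (grad f x)).
Proof.
move=> fC; apply: is_diff_from_increments => [|e e0].
  exact: dotv_continuous.
have [r r0 rf] := Ck1_strictly_differentiable x fC e0.
exists r => // w wr; have := rf (w + x) x.
rewrite addrK subrr normr0 => /(_ _ r0); apply.
by rewrite opprD addrCA subrr addr0 normrN.
Qed.

Lemma Ck1_derive (R : realType) n (f : 'cV[R]_n -> R) (x w : 'cV[R]_n) :
  Ck 1 f -> 'D_w f x = dotv (grad f x) w.
Proof.
by move=> fC; have [df dfE] := Ck1_is_diff x fC; rewrite deriveE// dfE.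
Qed.

Lemma Ck1_comp_derive (R : realType) n (f : 'cV[R]_n -> R)
    (q : R -> 'cV[R]_n) (t : R) :
  Ck 1 f -> derivable q t 1 ->
  is_derive t 1 (f \o q) (dotv (grad f (q t)) ('D_1 q t)).
Proof.
move=> fC /derivable1_diffP dq; have [df dfE] := Ck1_is_diff (q t) fC.
have dfq : differentiable (f \o q) t by exact: differentiable_comp.
split; first exact/derivable1_diffP.
by rewrite (deriveE _ dfq) (diff_comp dq df) /= dfE (deriveE _ dq).
Qed.

Lemma is_derive_linear_comp (R : realType) (V W : normedModType R)
    (f : {linear V -> W}) (y : R -> V) (t : R) :
  continuous f -> derivable y t 1 -> is_derive t 1 (f \o y) (f ('D_1 y t)).
Proof.
move=> fc /derivable1_diffP dy.
have df x : differentiable f x := linear_differentiable x fc.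
have dfy : differentiable (f \o y) t by apply: differentiable_comp.
split; first exact/derivable1_diffP.
rewrite (deriveE _ dfy) (diff_comp dy (df _)) /=.
by rewrite (diff_lin _ fc) (deriveE _ dy).
Qed.

Lemma is_derive_fst (R : realType) (V W : normedModType R) (y : R -> V * W)
    (t : R) : derivable y t 1 -> is_derive t 1 (fst \o y) ('D_1 y t).1.
Proof.
apply: (is_derive_linear_comp (f := fst)).
by move=> x; exact: cvg_fst.
Qed.

Lemma is_derive_snd (R : realType) (V W : normedModType R) (y : R -> V * W)
    (t : R) : derivable y t 1 -> is_derive t 1 (snd \o y) ('D_1 y t).2.
Proof.
apply: (is_derive_linear_comp (f := snd)).
by move=> x; exact: cvg_snd.
Qed.

Lemma dotv_field_sum (R : realType) n (w : 'cV[R]_n -> 'cV[R]_n)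
    (v : 'cV[R]_n) :
  (fun x => dotv (w x) v) = \sum_(i < n) (v i 0 *: (fun x => w x i 0)).
Proof.
apply/funext => x; rewrite dotvE fct_sumE; apply: eq_bigr => i _.
by rewrite mulrC.
Qed.

Lemma derivable_dotv_field (R : realType) n (w : 'cV[R]_n -> 'cV[R]_n)
    (v x h : 'cV[R]_n) :
  (forall i, Ck 1 (fun x => w x i 0)) -> derivable (fun x => dotv (w x) v) x h.
Proof.
move=> wC; rewrite dotv_field_sum; apply: derivable_sum => i.
by apply: derivableZ; have [+ _] := wC i h; apply.
Qed.

(** In the application [k] is the weight of the free dynamics: the auxiliary fields freeze the
    position, so it moves with velocity [k *: v] and the derivative term of [phi] appears with the
    factor [k]. *)
Lemma dotv_field_derive (R : realType) n (w : 'cV[R]_n -> 'cV[R]_n)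
    (q v : R -> 'cV[R]_n) (t k : R) :
  (forall i, Ck 1 (fun x => w x i 0)) ->
  derivable q t 1 -> derivable v t 1 -> 'D_1 q t = k *: v t ->
  is_derive t 1 (fun s => dotv (w (q s)) (v s))
    (k * 'D_(v t) (fun x => dotv (w x) (v t)) (q t)
     + dotv (w (q t)) ('D_1 v t)).
Proof.
move=> wC dq dv qE.
have wq i := Ck1_comp_derive (wC i) dq.
have vi i : is_derive t 1 (fun s => v s i 0) ('D_1 v t i 0).
  split; first by move/derivable_mxP : dv => /(_ i 0).
  by rewrite derive_mx// mxE.
have -> : (fun s => dotv (w (q s)) (v s)) =
    \sum_(i < n) ((fun s => w (q s) i 0) * (fun s => v s i 0)).
  by apply/funext => s; rewrite dotvE fct_sumE; apply: eq_bigr.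
apply: is_derive_eq; rewrite dotv_field_sum.
have dw i x : derivable (fun x => w x i 0) x (v t).
  by have [+ _] := wC i (v t); apply.
rewrite derive_sum; last by move=> i; exact: derivableZ.
rewrite dotvE mulr_sumr -big_split/=; apply: eq_bigr => i _.
by rewrite deriveZ// Ck1_derive// qE linearZ/= /GRing.scale/=; ring.
Qed.

(** * Locally Lipschitz functions *)

Lemma Ck1_locally_lipschitz (R : realType) n (f : 'cV[R]_n -> R) x :
  Ck 1 f -> locally_lipschitz_at f x.
Proof.
move=> fC; have [r r0 rf] := Ck1_strictly_differentiable x fC ltr01.
(* The sum bounds the linear part; the 1 is the error allowed in strict differentiability. *)
exists r, (\sum_i `|grad f x i 0| + 1); split=> //.
  by rewrite ltr_wpDl// sumr_ge0.
move=> x1 x2 x1r x2r; rewrite mulrDl.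
have := lerD (dotv_le_norm (grad f x) (x1 - x2)) (rf _ _ x1r x2r).
by apply: le_trans; rewrite (le_trans _ (ler_normD _ _))// subrKC.
Qed.

Lemma locally_lipschitz_proj (R : realType) (V W : normedModType R)
    (p : V -> W) (f : W -> R) x :
  (forall x1 x2, `|p x1 - p x2| <= `|x1 - x2|) ->
  locally_lipschitz_at f (p x) -> locally_lipschitz_at (f \o p) x.
Proof.
move=> pL [r [L [r0 L0 rf]]]; exists r, L; split=> // x1 x2 x1r x2r.
rewrite /= (le_trans (rf _ _ _ _))//; last by rewrite ler_pM2l.
- exact: le_lt_trans (pL _ _) x1r.
- exact: le_lt_trans (pL _ _) x2r.
Qed.

Section locally_lipschitz.
Variables (R : realType) (V : normedModType R).
Implicit Types (f g : V -> R) (x : V).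

Lemma locally_lipschitzN f x :
  locally_lipschitz_at f x -> locally_lipschitz_at (\- f) x.
Proof.
move=> [r [L [r0 L0 rf]]]; exists r, L; split=> // x1 x2 x1r x2r /=.
by rewrite -opprD normrN; exact: rf.
Qed.

Lemma locally_lipschitzD f g x :
  locally_lipschitz_at f x -> locally_lipschitz_at g x ->
  locally_lipschitz_at (f \+ g) x.
Proof.
move=> [r [L [r0 L0 rf]]] [r' [L' [r'0 L'0 rg]]].
exists (Num.min r r'), (L + L'); split; first by rewrite lt_min r0.
  exact: addr_gt0.
move=> x1 x2; rewrite !lt_min => /andP[x1r x1r'] /andP[x2r x2r'] /=.
by rewrite opprD addrACA mulrDl (le_trans (ler_normD _ _))// lerD// (rf, rg).
Qed.

Lemma locally_lipschitzM f g x :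
  locally_lipschitz_at f x -> locally_lipschitz_at g x ->
  locally_lipschitz_at (f \* g) x.
Proof.
move=> [r [L [r0 L0 rf]]] [r' [L' [r'0 L'0 rg]]].
have bnd h s K z : 0 < s -> 0 < K -> (forall x1 x2, `|x - x1| < s ->
    `|x - x2| < s -> `|h x1 - h x2| <= K * `|x1 - x2|) ->
    `|x - z| < s -> `|h z| <= `|h x| + K * s.
  move=> s0 K0 hs zs; rewrite -[h z](subKr (h x)).
  rewrite (le_trans (ler_normB _ _))// lerD2l.
  apply: (@le_trans _ _ (K * `|x - z|)).
    by apply: hs => //; rewrite subrr normr0.
  by rewrite ler_wpM2l// ltW.
exists (Num.min r r'), (L * (`|g x| + L' * r') + (`|f x| + L * r) * L'); split.
- by rewrite lt_min r0.
- by rewrite addr_gt0// mulr_gt0// ltr_wpDl// mulr_gt0.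
move=> x1 x2; rewrite !lt_min => /andP[x1r x1r'] /andP[x2r x2r'] /=.
rewrite (_ : _ - _ = (f x1 - f x2) * g x1 + f x2 * (g x1 - g x2)); last by ring.
rewrite [leRHS]mulrDl (le_trans (ler_normD _ _))// !normrM lerD//.
  rewrite [leRHS]mulrAC ler_pM//; first exact: rf.
  exact: bnd rg x1r'.
rewrite -mulrA ler_pM//; first exact: bnd rf x2r.
exact: rg.
Qed.

Lemma locally_lipschitz_sum n (f : 'I_n -> V -> R) x :
  (forall i, locally_lipschitz_at (f i) x) ->
  locally_lipschitz_at (fun z => \sum_i f i z) x.
Proof.
elim: n f => [|n IH] f fL.
  exists 1, 1; split=> // x1 x2 _ _.
  by rewrite !big_ord0 subrr normr0 mul1r.
rewrite (_ : (fun z => _) =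
    (fun z => \sum_i f (widen_ord (leqnSn n) i) z) \+ f ord_max).
  by apply: locally_lipschitzD => //; apply: IH.
by apply/funext => z; rewrite big_ord_recr.
Qed.

Lemma locally_lipschitz_continuous f :
  (forall x, locally_lipschitz_at f x) -> continuous f.
Proof.
move=> fL x; have [r [L [r0 L0 rf]]] := fL x.
apply/cvgrPdist_le => e e0; near=> z.
apply: (@le_trans _ _ (L * `|x - z|)).
  apply: rf; first by rewrite subrr normr0.
  near: z.
  by apply: (@cvgr_dist_lt _ _ _ _ (nbhs_filter x) id x); [exact: cvg_id|].
rewrite mulrC -ler_pdivlMr//; near: z.
by apply: (@cvgr_dist_le _ _ _ _ (nbhs_filter x) id x);
  [exact: cvg_id|exact: divr_gt0].
Unshelve. all: by end_near. Qed.

End locally_lipschitz.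

(** * Inner products and inverses of positive definite matrices *)

Lemma dotvC (R : realType) n (a w : 'cV[R]_n) : dotv a w = dotv w a.
Proof. by rewrite !dotvE; apply: eq_bigr => i _; rewrite mulrC. Qed.

Lemma dotvD (R : realType) n (a v w : 'cV[R]_n) :
  dotv a (v + w) = dotv a v + dotv a w.
Proof. exact: raddfD. Qed.

Lemma dotvZ (R : realType) n (a w : 'cV[R]_n) k :
  dotv a (k *: w) = k * dotv a w.
Proof. exact: linearZ. Qed.

Lemma dotv_mulmx_tr (R : realType) n (A : 'M[R]_n) (a w : 'cV[R]_n) :
  dotv a (A *m w) = dotv (A^T *m a) w.
Proof. by rewrite /dotv trmx_mul trmxK mulmxA. Qed.

Section positive_definite.
Variables (R : realType) (n : nat) (A : 'M[R]_n).
Hypothesis A_sym : A^T = A.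
Hypothesis A_pos : forall w : 'cV[R]_n, w != 0 -> 0 < dotv w (A *m w).

Lemma posdef_unitmx : A \in unitmx.
Proof.
rewrite unitmxE unitfE; apply/negP => /det0P[v v0 vA].
have vT0 : v^T != 0.
  by apply: contra_neq v0 => /(congr1 trmx); rewrite trmxK trmx0.
have := A_pos vT0; rewrite -[A]A_sym -trmx_mul vA trmx0 /dotv mulmx0 mxE.
by rewrite ltxx.
Qed.

Lemma invmx_posdef_sym (a w : 'cV[R]_n) :
  dotv a (invmx A *m w) = dotv w (invmx A *m a).
Proof. by rewrite dotv_mulmx_tr trmx_inv A_sym dotvC. Qed.

(** Substituting [a = A *m w] turns the form of the inverse at [a] into that of [A] at [w]. *)
Lemma invmx_posdef_gt0 (a : 'cV[R]_n) : a != 0 -> 0 < dotv a (invmx A *m a).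
Proof.
move=> a0; have aE : a = A *m (invmx A *m a) by rewrite mulKVmx// posdef_unitmx.
rewrite dotvC {2}aE; apply: A_pos; apply: contra_neq a0 => w0.
by rewrite aE w0 mulmx0.
Qed.

Lemma invmx_posdef_ge0 (a : 'cV[R]_n) : 0 <= dotv a (invmx A *m a).
Proof.
have [->|/invmx_posdef_gt0/ltW//] := eqVneq a 0.
by rewrite mulmx0 /dotv mulmx0 mxE.
Qed.

End positive_definite.

(** * Regularity of the switching functions *)

Lemma norm_fst_le (R : realType) (V W : normedModType R) (z : V * W) :
  `|z.1| <= `|z|.
Proof. by rewrite prod_normE/= le_max lexx. Qed.

Lemma norm_snd_le (R : realType) (V W : normedModType R) (z : V * W) :
  `|z.2| <= `|z|.
Proof. by rewrite prod_normE/= le_max lexx orbT. Qed.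

Lemma Ck1_entry (R : realType) n (w : 'cV[R]_n -> 'cV[R]_n) i :
  Ck 1 w -> Ck 1 (fun x => w x i 0).
Proof.
move=> wC h; have [dw Dwc] := wC h.
have dwi x : derivable (fun x => w x i 0) x h.
  by have /derivable_mxP := dw x; apply.
split=> //=.
rewrite (_ : (fun x => _) = (fun A : 'cV[R]_n => A i 0) \o (fun x => 'D_h w x)).
  move=> x; apply: continuous_comp; first exact: Dwc.
  exact: coord_continuous.
by apply/funext => x /=; rewrite derive_mx// mxE.
Qed.

(** [Ck] asks for continuity only at its last level, so continuity of the first derivatives must be
    recovered; it follows from their being locally Lipschitz. *)
Lemma Ck2_Ck1 (R : realType) n (f : 'cV[R]_n -> R) : Ck 2 f -> Ck 1 f.
Proof.
move=> fC h; have [df Df] := fC h; split=> //.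
by apply: locally_lipschitz_continuous => x; exact: Ck1_locally_lipschitz.
Qed.

Lemma Ck2_nrm (R : realType) n (fc : 'cV[R]_n -> R) i :
  Ck 2 fc -> Ck 1 (fun x => nrm fc x i 0).
Proof.
move=> /(_ (ecol R i))[_].
rewrite [X in _ -> Ck 1 X](_ : _ = 'D_(ecol R i) fc)//.
by apply/funext => x; rewrite mxE.
Qed.

Section switching_functions.
Variables (R : realType) (nq : nat).
Local Notation Y := (('cV[R]_nq * 'cV[R]_nq) * R)%type.

Lemma locally_lipschitz_position (f : 'cV[R]_nq -> R) (y : Y) :
  Ck 1 f -> locally_lipschitz_at (fun z : Y => f z.1.1) y.
Proof.
move=> fC.
apply: (@locally_lipschitz_proj R Y 'cV[R]_nq (fun z : Y => z.1.1) f).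
  move=> x1 x2; apply: le_trans (norm_fst_le (x1.1 - x2.1)) _.
  exact: (norm_fst_le (x1 - x2)).
exact: Ck1_locally_lipschitz.
Qed.

Lemma locally_lipschitz_velocity (w : 'cV[R]_nq -> 'cV[R]_nq) (y : Y) :
  (forall i, Ck 1 (fun x => w x i 0)) ->
  locally_lipschitz_at (fun z : Y => dotv (w z.1.1) z.1.2) y.
Proof.
move=> wC; under [X in locally_lipschitz_at X]eq_fun do rewrite dotvE.
apply: locally_lipschitz_sum => i; apply: locally_lipschitzM.
  exact: (locally_lipschitz_position y (wC i)).
exists 1, 1; split=> // x1 x2 _ _; rewrite mul1r.
apply: (le_trans _ (norm_fst_le (x1 - x2))).
apply: (le_trans _ (norm_snd_le (x1.1 - x2.1))).
by have := mx_entry_le_norm (x1.1 - x2.1).2 i 0; rewrite !mxE.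
Qed.
End switching_functions.

(** * Closures of the regions and Filippov weights *)

Lemma closure_le0 (R : realType) (T : topologicalType) (g : T -> R)
    (A : set T) (x : T) :
  continuous g -> (forall z, A z -> g z <= 0) -> closure A x -> g x <= 0.
Proof.
move=> gc gA Ax; rewrite leNgt; apply/negP => gx.
have [z [Az gz]] := Ax _ (cvgr_gt (g x) (gc x) 0 gx).
by move: gz; rewrite /= ltNge gA.
Qed.

Section filippov.
Variables (R : realType) (nq nu : nat).
Local Notation Q := 'cV[R]_nq.
Local Notation Y := ((Q * Q) * R)%type.
Variables (fv : Q * Q * 'cV[R]_nu -> Q) (M : Q -> 'M[R]_nq) (fc : Q -> R)
          (b : Q -> Q) (mu an : R).
Hypotheses (fcC : Ck 2 fc) (bC : smooth b).

Lemma c1_locally_lipschitz y : locally_lipschitz_at (c1 fc) y.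
Proof. exact/locally_lipschitz_position/Ck2_Ck1. Qed.

Lemma c2_locally_lipschitz y : locally_lipschitz_at (c2 fc) y.
Proof. by apply: locally_lipschitz_velocity => i; exact: Ck2_nrm. Qed.

Lemma c3_locally_lipschitz y : locally_lipschitz_at (c3 b) y.
Proof.
by apply: locally_lipschitz_velocity => i; apply: Ck1_entry; exact: bC.
Qed.

Let c1_cont := locally_lipschitz_continuous c1_locally_lipschitz.
Let c2_cont := locally_lipschitz_continuous c2_locally_lipschitz.
Let c3_cont := locally_lipschitz_continuous c3_locally_lipschitz.

Lemma closure_R1 y : closure (R1 fc) y -> 0 <= c1 fc y \/ 0 <= c2 fc y.
Proof.
move=> Ry; have [c1y|c1y] := leP 0 (c1 fc y); first by left.
have [c2y|c2y] := leP 0 (c2 fc y); first by right.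
have n1 := @cvgr_lt _ _ _ (nbhs_filter y) _ _ (@c1_cont y) 0 c1y.
have n2 := @cvgr_lt _ _ _ (nbhs_filter y) _ _ (@c2_cont y) 0 c2y.
have [z [Rz [/= z2 z3]]] := Ry _ (filterI n1 n2).
case: Rz => [/= z1|[_ /= z1]].
  by move: z1; rewrite ltNge (ltW z2).
by move: z1; rewrite ltNge (ltW z3).
Qed.

Lemma closure_R2 y :
  closure (R2 fc b) y -> [/\ c1 fc y <= 0, c2 fc y <= 0 & 0 <= c3 b y].
Proof.
move=> Ry; split.
- by apply: closure_le0 Ry => // z [[/ltW]].
- by apply: closure_le0 Ry => // z [[_ /ltW]].
- rewrite -oppr_le0; apply: (@closure_le0 _ _ (\- c3 b)) Ry.
    by move=> x; exact/continuousN/c3_cont.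
  by move=> z [_ /ltW] /=; rewrite oppr_le0.
Qed.

Lemma closure_R3 y :
  closure (R3 fc b) y -> [/\ c1 fc y <= 0, c2 fc y <= 0 & c3 b y <= 0].
Proof.
move=> Ry; split.
- by apply: closure_le0 Ry => // z [[/ltW]].
- by apply: closure_le0 Ry => // z [[_ /ltW]].
- by apply: closure_le0 Ry => // z [_ /ltW].
Qed.

(* [th1] is the weight of the free dynamics [f1] and [d] the signed weight
   [th3 - th2] of the tangential auxiliary dynamics. *)
Definition filippov_weights (y : Y) (z : Y) (u : 'cV[R]_nu) (th1 d : R) :=
  [/\ (0 < c1 fc y \/ 0 < c2 fc y -> th1 = 1),
      (c1 fc y < 0 -> c2 fc y < 0 -> th1 = 0),
      (0 < c3 b y -> d = th1 - 1), (c3 b y < 0 -> d = 1 - th1) &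
      z = (th1 *: y.1.2, th1 *: fv (y.1.1, y.1.2, u) +
        invmx (M y.1.1) *m (((1 - th1) * an) *: nrm fc y.1.1
                            + (d * (mu * an)) *: b y.1.1), th1)].

(** The auxiliary weights enter the velocity only through their sum [1 - th1], along the normal, and
    their difference, along [b]. A strict sign of [c3] excludes one of the two fields, which makes
    the difference plus or minus the sum. *)
Lemma F_TF_weights y u z :
  F_TF fv M fc b mu an y u z -> exists th1 d, filippov_weights y z u th1 d.
Proof.
move=> [th1 [th2 [th3 [[p1 p2 p3] s1 [H1 H2 H3] ->]]]].
have R2' : ~ [/\ c1 fc y <= 0, c2 fc y <= 0 & 0 <= c3 b y] -> th2 = 0.
  by move=> h; apply: H2 => /closure_R2.
have R3' : ~ [/\ c1 fc y <= 0, c2 fc y <= 0 & c3 b y <= 0] -> th3 = 0.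
  by move=> h; apply: H3 => /closure_R3.
exists th1, (th3 - th2); split.
- move=> c12; move: s1; rewrite R2' ?R3' ?addr0// => -[].
    by case: c12 => ? ? ?; lra.
  by case: c12 => ? ? ?; lra.
- move=> c1y c2y; apply: H1 => /closure_R1; lra.
- move=> c3y; have : th3 = 0 by apply: R3' => -[_ _ ?]; lra.
  by move=> ?; lra.
- move=> c3y; have : th2 = 0 by apply: R2' => -[_ _ ?]; lra.
  by move=> ?; lra.
- rewrite /f1 /f2 /f3 /faux_tp /faux_tm /faux_n /at_.
  have -> : 1 - th1 = th2 + th3 by lra.
  congr (_, _, _) => /=.
  + by rewrite oppr0 !addr0 !scaler0 !addr0.
  + rewrite mulmxDr -!scalemxAr.
    move: (invmx _ *m nrm _ _) (invmx _ *m b _) => A B.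
    by apply/matrixP => i j; rewrite !mxE; ring.
  + by rewrite oppr0 !addr0 !scaler0 !addr0 [_ *: _]mulr1.
Qed.

End filippov.

(** * Derivatives along solutions and sliding-mode velocities *)

Section dynamics.
Variables (R : realType) (nq nu : nat).
Local Notation Q := 'cV[R]_nq.
Local Notation Y := ((Q * Q) * R)%type.
Variables (fv : Q * Q * 'cV[R]_nu -> Q) (M : Q -> 'M[R]_nq) (fc : Q -> R)
          (b : Q -> Q) (mu an : R).
Hypotheses (fcC : Ck 2 fc) (bC : smooth b).
Hypothesis M_sym : forall q, (M q)^T = M q.
Hypothesis M_pos : forall q (w : Q), w != 0 -> 0 < dotv w (M q *m w).
Hypothesis bMn : forall q, dotv (b q) (invmx (M q) *m nrm fc q) = 0.

(** This orthogonality decouples the contact directions: the tangential auxiliary field does not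
    change the normal velocity. *)
Let nMb q : dotv (nrm fc q) (invmx (M q) *m b q) = 0.
Proof. by rewrite invmx_posdef_sym. Qed.

(* The analogue of [phi] for the tangential direction [b]. *)
Definition phib (q v : Q) (u : 'cV[R]_nu) : R :=
  dotv (b q) (fv (q, v, u)) + 'D_v (fun q' => dotv (b q') v) q.

Definition Db (q : Q) : R := dotv (b q) (invmx (M q) *m b q).

Section switching_derivatives.
Variables (y : R -> Y) (u : 'cV[R]_nu) (t th1 d : R).
Hypothesis dy : derivable y t 1.
Hypothesis yw : filippov_weights fv M fc b mu an (y t) ('D_1 y t) u th1 d.

Let dqv : is_derive t 1 (fst \o y) ('D_1 y t).1 := is_derive_fst dy.
Let dq : is_derive t 1 (fst \o (fst \o y)) ('D_1 y t).1.1.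
Proof. by have [dyv <-] := dqv; exact: is_derive_fst. Qed.
Let dv : is_derive t 1 (snd \o (fst \o y)) ('D_1 y t).1.2.
Proof. by have [dyv <-] := dqv; exact: is_derive_snd. Qed.

Lemma c1_derive : is_derive t 1 (c1 fc \o y) (th1 * c2 fc (y t)).
Proof.
have [dq' Eq] := dq.
have := Ck1_comp_derive (Ck2_Ck1 fcC) dq'.
by rewrite Eq; have [_ _ _ _ ->] := yw; rewrite /= dotvZ.
Qed.

Let dotv_derive (w : Q -> Q) : (forall i, Ck 1 (fun x => w x i 0)) ->
  is_derive t 1 (fun s => dotv (w (y s).1.1) (y s).1.2)
    (th1 * 'D_((y t).1.2) (fun x => dotv (w x) (y t).1.2) (y t).1.1
     + dotv (w (y t).1.1) ('D_1 y t).1.2).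
Proof.
move=> wC; have [dq' Eq] := dq; have [dv' Ev] := dv.
have Eth : 'D_1 (fst \o (fst \o y)) t = th1 *: (snd \o (fst \o y)) t.
  by rewrite Eq; have [_ _ _ _ ->] := yw.
by have := dotv_field_derive wC dq' dv' Eth; rewrite Ev.
Qed.

Lemma c2_derive : is_derive t 1 (c2 fc \o y)
  (th1 * phi fv fc (y t).1.1 (y t).1.2 u + (1 - th1) * an * Dq M fc (y t).1.1).
Proof.
have /dotv_derive : forall i, Ck 1 (fun x => nrm fc x i 0).
  by move=> i; exact: Ck2_nrm.
congr (is_derive _ _ _ _); have [_ _ _ _ ->] := yw => /=.
rewrite dotvD dotvZ mulmxDr -!scalemxAr dotvD !dotvZ nMb /phi /Dq; ring.
Qed.

Lemma c3_derive : is_derive t 1 (c3 b \o y)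
  (th1 * phib (y t).1.1 (y t).1.2 u + d * (mu * an) * Db (y t).1.1).
Proof.
have /dotv_derive : forall i, Ck 1 (fun x => b x i 0).
  by move=> i; apply: Ck1_entry; exact: bC.
congr (is_derive _ _ _ _); have [_ _ _ _ ->] := yw => /=.
rewrite dotvD dotvZ mulmxDr -!scalemxAr dotvD !dotvZ bMn /phib /Db; ring.
Qed.

End switching_derivatives.

Section sliding.
Variables (q v : Q) (u : 'cV[R]_nu).
Hypotheses (an0 : 0 < an) (n0 : nrm fc q != 0) (b0 : b q != 0).
Hypothesis phi0 : phi fv fc q v u <= 0.

Lemma Dq_gt0 : 0 < Dq M fc q.
Proof. exact: (invmx_posdef_gt0 (M_sym q) (@M_pos q) n0). Qed.

Lemma gamma_itv : 0 < gamma fv M fc an q v u <= 1.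
Proof.
have Da : 0 < Dq M fc q * an by rewrite mulr_gt0// Dq_gt0.
have h : 0 < Dq M fc q * an - phi fv fc q v u.
  by rewrite subr_gt0 (le_lt_trans phi0).
by rewrite divr_gt0//= ler_pdivrMr// mul1r lerDl oppr_ge0.
Qed.

(** This is the origin of [gamma]: the equation is linear in [th1], with coefficient [D a_n - phi],
    positive because [phi <= 0]. *)
Lemma sliding_weight th1 :
  th1 * phi fv fc q v u + (1 - th1) * an * Dq M fc q = 0 ->
  th1 = gamma fv M fc an q v u.
Proof.
have Da : 0 < Dq M fc q * an by rewrite mulr_gt0// Dq_gt0.
have h : Dq M fc q * an - phi fv fc q v u != 0.
  by rewrite gt_eqF// subr_gt0 (le_lt_trans phi0).
by move=> E; apply: (mulIf h); rewrite /gamma divfK//; lra.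
Qed.

(** The normal push [(1 - g) * an] equals [- g * phi / D], which is [g] times the contact force.
    Since the tangential constant is [mu * an], the same identity produces the friction force with
    ratio [mu]. *)
Lemma slip_velocity g d :
  g = gamma fv M fc an q v u ->
  d = (g - 1) * (vt b q v / `|vt b q v|) ->
  g *: fv (q, v, u) + invmx (M q) *m
    (((1 - g) * an) *: nrm fc q + (d * (mu * an)) *: b q) =
  g *: fSlip_v fv M fc b mu q v u.
Proof.
move=> gE0 ->.
have Da : 0 < Dq M fc q * an by rewrite mulr_gt0// Dq_gt0.
have h : Dq M fc q * an - phi fv fc q v u != 0.
  by rewrite gt_eqF// subr_gt0 (le_lt_trans phi0).
have gE : (1 - g) * an = - (g * (phi fv fc q v u / Dq M fc q)).
  rewrite gE0 /gamma; field; rewrite h gt_eqF//; exact: Dq_gt0.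
rewrite /fSlip_v scalerBr; congr (_ + _).
rewrite scalerA -scaleNr -gE scalemxAr; congr (_ *m _).
rewrite scalerBr scalerA -scaleNr; congr (_ + _ *: _); ring.
Qed.

(** The derivative of the two-row column is computed entrywise, which first requires both entries to
    be derivable. *)
Lemma phitilE : phitil fv fc b q v u =
  col_mx (phi fv fc q v u)%:M (phib q v u)%:M.
Proof.
have dn := @derivable_dotv_field _ _ _ v q v (fun i => Ck2_nrm i fcC).
have db := @derivable_dotv_field _ _ _ v q v (fun i => Ck1_entry i (bC 1)).
have NE : (fun q' => (Nm fc b q')^T *m v) =
    (fun q' => col_mx (dotv (nrm fc q') v)%:M (dotv (b q') v)%:M).
  apply/funext => x; rewrite tr_row_mx mul_col_mx.
  by congr col_mx; apply/matrixP => i j; rewrite !ord1 [RHS]mxE eqxx mulr1n.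
have eL (f g : Q -> R) (k : 'I_1) :
    (fun x => (col_mx (f x)%:M (g x)%:M : 'cV[R]_(1 + 1)) (lshift 1 k) 0) = f.
  by apply/funext => x; rewrite col_mxEu ord1 mxE eqxx mulr1n.
have eR (f g : Q -> R) (k : 'I_1) :
    (fun x => (col_mx (f x)%:M (g x)%:M : 'cV[R]_(1 + 1)) (rshift 1 k) 0) = g.
  by apply/funext => x; rewrite col_mxEd ord1 mxE eqxx mulr1n.
rewrite /phitil NE tr_row_mx mul_col_mx derive_mx; last first.
  apply/derivable_mxP => i j; rewrite [j]ord1.
  rewrite -[i]splitK; case: (fintype.split i) => k.
    by rewrite eL; exact: dn.
  by rewrite eR; exact: db.
apply/matrixP => i j; rewrite [j]ord1 [LHS]mxE.
rewrite -[i]splitK; case: (fintype.split i) => k; rewrite [X in _ + X]mxE.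
  rewrite [unsplit _]/(lshift 1 k) eL !col_mxEu [k]ord1.
  by rewrite [RHS]mxE eqxx mulr1n.
rewrite [unsplit _]/(rshift 1 k) eR !col_mxEd [k]ord1.
by rewrite [RHS]mxE eqxx mulr1n.
Qed.

Lemma DtilE : Dtil M fc b q = block_mx (Dq M fc q)%:M 0 0 (Db q)%:M.
Proof.
rewrite /Dtil /Nm tr_row_mx mul_col_mx mul_col_row.
congr block_mx; apply/matrixP => i j; rewrite !ord1 [RHS]mxE -mulmxA.
- by rewrite eqxx mulr1n.
- exact: nMb.
- exact: bMn.
- by rewrite eqxx mulr1n.
Qed.

Lemma stick_velocity th1 d :
  th1 * phi fv fc q v u + (1 - th1) * an * Dq M fc q = 0 ->
  th1 * phib q v u + d * (mu * an) * Db q = 0 ->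
  th1 *: fv (q, v, u) + invmx (M q) *m
    (((1 - th1) * an) *: nrm fc q + (d * (mu * an)) *: b q) =
  th1 *: fStick_v fv M fc b q v u.
Proof.
move=> E1 E2; rewrite /fStick_v scalerBr; congr (_ + _).
(* [l] collects the normal and tangential contact forces supplied by the auxiliary fields; the two
   hypotheses say that [Dtil *m l = - (th1 *: phitil)], so inverting [Dtil] gives [l] without
   solving for [d]. *)
pose l : 'cV[R]_(1 + 1) := col_mx ((1 - th1) * an)%:M (d * (mu * an))%:M.
have Du : Dtil M fc b q \in unitmx.
  rewrite DtilE unitmxE det_lblock !det_scalar1 unitfE mulf_neq0//.
    by rewrite gt_eqF// Dq_gt0.
  by rewrite gt_eqF//; exact: (invmx_posdef_gt0 (M_sym q) (@M_pos q) b0).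
have Dl : Dtil M fc b q *m l = - (th1 *: phitil fv fc b q v u).
  rewrite DtilE phitilE mul_block_col !mul0mx addr0 add0r scale_col_mx.
  rewrite opp_col_mx; congr col_mx; apply/matrixP => i j.
    by rewrite !ord1 mul_scalar_mx !mxE !mulr1n; lra.
  by rewrite !ord1 mul_scalar_mx !mxE !mulr1n; lra.
have -> : ((1 - th1) * an) *: nrm fc q + (d * (mu * an)) *: b q =
    Nm fc b q *m l.
  by rewrite mul_row_col !mul_mx_scalar.
rewrite -[l](mulKmx Du) Dl mulmxN -scalemxAr.
by rewrite !mulmxN -!scalemxAr !mulmxA.
Qed.

End sliding.
End dynamics.

Unset Implicit Arguments.

Theorem theorem3 (R : realType) (nq nu : nat)
  (fv : 'cV[R]_nq * 'cV[R]_nq * 'cV[R]_nu -> 'cV[R]_nq)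
  (M : 'cV[R]_nq -> 'M[R]_nq) (fc : 'cV[R]_nq -> R)
  (b : 'cV[R]_nq -> 'cV[R]_nq) (mu an : R)
  (y : R -> 'cV[R]_nq * 'cV[R]_nq * R) (u : R -> 'cV[R]_nu) (tauf : R) :
  (* regularity *)
  Ck 2 fv -> Ck 2 M -> Ck 2 fc -> smooth b ->
  (* M(q) symmetric positive definite *)
  (forall q, (M q)^T = M q /\
     forall w : 'cV[R]_nq, w != 0 -> 0 < dotv w (M q *m w)) ->
  (* planar contact: b^T M^{-1} n = 0 *)
  (forall q, dotv (b q) (invmx (M q) *m nrm fc q) = 0) ->
  (* regular contact: n(q) and b(q) nonzero at contact points *)
  (forall q, fc q = 0 -> nrm fc q != 0 /\ b q != 0) ->
  0 < mu -> 0 < an -> 0 <= tauf ->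
  (* y is a solution of the time-freezing Filippov system on [0, tauf] *)
  TF_solution fv M fc b mu an y u tauf ->
  Sigma fc (y 0) ->
  (* persistent contact *)
  (forall tau, 0 <= tau <= tauf ->
     phi fv fc (y tau).1.1 (y tau).1.2 (u tau) <= 0) ->
  (* the motion is a sliding mode on Sigma, gamma in (0,1] along it ... *)
  (forall tau, 0 <= tau <= tauf ->
     Sigma fc (y tau) /\
     0 < gamma fv M fc an (y tau).1.1 (y tau).1.2 (u tau) <= 1) /\
  (* ... and its dynamics are the rescaled slip / stick dynamics *)
  {ae (@lebesgue_measure R), forall tau, tau \in `[0, tauf] ->
     let q := (y tau).1.1 in let v := (y tau).1.2 in
     let g := gamma fv M fc an q v (u tau) in
     derivable y tau 1 /\
     (vt b q v != 0 ->
        'D_1 y tau = (g *: v, g *: fSlip_v fv M fc b mu q v (u tau), g)) /\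
     (vt b q v = 0 ->
        'D_1 y tau = (g *: v, g *: fStick_v fv M fc b q v (u tau), g))}.
Proof.
move=> _ _ fcC bC M_sp bMn nb0 mu0 an0 T0 [yac yae] Sy0 phi0.
have M_sym q : (M q)^T = M q by have [] := M_sp q.
have M_pos q : forall w : 'cV[R]_nq, w != 0 -> 0 < dotv w (M q *m w).
  by have [] := M_sp q.
pose good t := t \in `[0, tauf] -> derivable y t 1 /\
  exists th1 d, filippov_weights fv M fc b mu an (y t) ('D_1 y t) (u t) th1 d.
have gae : {ae (@lebesgue_measure R), forall t, good t}.
  refine (negligibleS _ yae); apply: subsetC => t /= yt tT.
  by have [dy yF] := yt tT; split=> //; exact: (F_TF_weights fcC bC yF).
have phi0' t : t \in `[0, tauf] -> phi fv fc (y t).1.1 (y t).1.2 (u t) <= 0.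
  by rewrite in_itv/=; exact: phi0.
have [Sc1 Sc2] := Sy0.
have c2_le0 : forall t, 0 <= t <= tauf -> c2 fc (y t) <= 0.
  apply: (barrier yac (c2_locally_lipschitz fcC)); first by rewrite Sc2.
  refine (negligibleS _ gae); apply: subsetC => t /= gt tT c2y.
  have [dy [th1 [d yw]]] := gt tT.
  have [dc ->] := c2_derive fcC M_sym bMn dy yw; split=> //.
  have -> : th1 = 1 by have [h _ _ _ _] := yw; apply: h; right.
  by rewrite subrr !mul0r addr0 mul1r phi0'.
have c1_le0 : forall t, 0 <= t <= tauf -> c1 fc (y t) <= 0.
  apply: (barrier yac (c1_locally_lipschitz fcC)); first by rewrite Sc1.
  refine (negligibleS _ gae); apply: subsetC => t /= gt tT c1y.
  have [dy [th1 [d yw]]] := gt tT.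
  have [dc ->] := c1_derive fcC dy yw; split=> //.
  have -> : th1 = 1 by have [h _ _ _ _] := yw; apply: h; left.
  by rewrite mul1r c2_le0// -in_itv.
(* Where [c1] vanishes its derivative [th1 * c2] vanishes as well, so [c2 < 0]
   switches the free dynamics off almost everywhere. *)
have c2_ge0 : forall t, 0 <= t <= tauf -> - c2 fc (y t) <= 0.
  apply: (@barrier _ _ y (\- c2 fc) tauf yac) => [x||].
  - exact/locally_lipschitzN/c2_locally_lipschitz.
  - by rewrite /= Sc2 oppr0.
  refine (negligibleS _
    (negligibleU gae (ae_derive_eq0_on_zeros (c1 fc \o y)))).
  rewrite -setCI; apply: subsetC => t /= [gt z1] tT; rewrite oppr_gt0 => c2y.
  have [dy [th1 [d yw]]] := gt tT.
  have th10 : th1 = 0.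
    have [_ th10 _ _ _] := yw.
    have [c1y|c1y|c1y] := ltgtP (c1 fc (y t)) 0; first exact: th10.
      by have := c1_le0 t tT; rewrite leNgt c1y.
    have [dc1 Dc1] := c1_derive fcC dy yw.
    move: (z1 c1y dc1); rewrite Dc1 => /eqP; rewrite mulf_eq0 => /orP[/eqP//|].
    by rewrite lt_eqF.
  have dc2 := c2_derive fcC M_sym bMn dy yw.
  have [dNc2 ->] := is_deriveN dc2; split=> //.
  rewrite th10 mul0r add0r subr0 mul1r oppr_le0 mulr_ge0 ?(ltW an0)//.
  exact: (invmx_posdef_ge0 (M_sym _) (M_pos _)).
have c2_eq0 t : 0 <= t <= tauf -> c2 fc (y t) = 0.
  move=> tT; apply/eqP; rewrite eq_le c2_le0//= -oppr_le0; exact: c2_ge0.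
(* The lower bound on [c1] comes last: once [c2] vanishes throughout, [c1' = th1 * c2] is zero
   whatever the weight. *)
have c1_ge0 : forall t, 0 <= t <= tauf -> - c1 fc (y t) <= 0.
  apply: (@barrier _ _ y (\- c1 fc) tauf yac) => [x||].
  - exact/locally_lipschitzN/c1_locally_lipschitz.
  - by rewrite /= Sc1 oppr0.
  refine (negligibleS _ gae); apply: subsetC => t /= gt tT _.
  have [dy [th1 [d yw]]] := gt tT.
  have dc1 := c1_derive fcC dy yw.
  have [dNc1 ->] := is_deriveN dc1; split=> //.
  by rewrite c2_eq0 ?mulr0 ?oppr0.
have onSigma t : 0 <= t <= tauf -> Sigma fc (y t).
  move=> tT; split; last exact: c2_eq0.
  by apply/eqP; rewrite eq_le c1_le0//= -oppr_le0; exact: c1_ge0.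
split=> [t tT|].
  split; first exact: onSigma.
  have [n0 _] := nb0 _ (onSigma t tT).1.
  exact: (gamma_itv M_sym M_pos an0 n0 (phi0 t tT)).
(* Also discarded are the times at which [c2] or [c3] vanishes with nonzero derivative. The times
   with [v_t = 0] may contain no interval, so [c3' = 0] could not be had from local constancy. *)
refine (negligibleS _ (negligibleU gae (negligibleU
  (ae_derive_eq0_on_zeros (c2 fc \o y)) (ae_derive_eq0_on_zeros (c3 b \o y))))).
rewrite -!setCI; apply: subsetC => t /= [gt [z2 z3]] tT.
have [dy [th1 [d yw]]] := gt tT.
have [n0 b0] := nb0 _ (onSigma t tT).1.
have [dc2 Dc2] := c2_derive fcC M_sym bMn dy yw.
have c2'0 := z2 (c2_eq0 t tT) dc2; rewrite Dc2 in c2'0.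
have th1E := sliding_weight M_sym M_pos an0 n0 (phi0 t tT) c2'0.
split=> //; split=> [vt0|vt0].
  have [_ _ dpos dneg ->] := yw; rewrite -th1E.
  have dE : d = (th1 - 1) *
      (vt b (y t).1.1 (y t).1.2 / `|vt b (y t).1.1 (y t).1.2|).
    have [vt1|vt1|/eqP] := ltgtP (vt b (y t).1.1 (y t).1.2) 0.
    - by rewrite (dneg vt1) (ltr0_norm vt1) invrN mulrN divff// mulrN1 opprB.
    - by rewrite (dpos vt1) (gtr0_norm vt1) divff// mulr1.
    - by rewrite (negbTE vt0).
  congr (_, _, _).
  exact: (@slip_velocity _ _ _ fv M fc b mu an M_sym M_pos _ _ _ an0 n0
    (phi0 t tT) _ _ th1E dE).
have [dc3 Dc3] := c3_derive bC bMn dy yw.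
have c3'0 := z3 vt0 dc3; rewrite Dc3 in c3'0.
have [_ _ _ _ ->] := yw; rewrite -th1E.
congr (_, _, _).
exact: (@stick_velocity _ _ _ fv M fc b mu an fcC bC M_sym M_pos bMn
  _ _ _ n0 b0 _ _ c2'0 c3'0).
Qed.
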